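(* Let $P$ be a finite poset and $p,q\in P$. In the chain toggle group $T(\mathcal{C}(P))$, $(t_pt_q)^2=1$ if and only if $p$ and $q$ are comparable in $P$.
   Context: A chain in a poset $P$ is a set of mutually comparable elements; $\mathcal{C}(P)\subseteq 2^P$ is the set of chains of $P$ (including $\emptyset$). For $p\in P$ the toggle $t_p:\mathcal{C}(P)\to\mathcal{C}(P)$ is given by $t_p(X)=X\cup\{p\}$ if $p\notin X$ and $X\cup\{p\}\in\mathcal{C}(P)$; $t_p(X)=X\setminus\{p\}$ if $p\in X$ and $X\setminus\{p\}\in\mathcal{C}(P)$; and $t_p(X)=X$ otherwise. $T(\mathcal{C}(P))$ is the subgroup of the symmetric group on $\mathcal{C}(P)$ generated by all $t_p$, $p\in P$. *)

(* Defs.v *)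
From HB Require Import structures.
From mathcomp Require Import all_boot all_order all_fingroup.

Set Implicit Arguments.
Unset Strict Implicit.
Unset Printing Implicit Defensive.

Import Order.TTheory.
Local Open Scope order_scope.
Local Open Scope group_scope.

Section ChainToggles.

Context {d : Order.disp_t} {P : finPOrderType d}.
Implicit Types (X Y : {set P}) (p : P).

Definition is_chain X : bool := [forall x in X, forall y in X, x >=< y].

Definition toggle_set p X : {set P} :=
  if (p \notin X) && is_chain (p |: X) then p |: X
  else if (p \in X) && is_chain (X :\ p) then X :\ p
  else X.

Lemma is_chainP X : reflect {in X &, forall x y, x >=< y} (is_chain X).
Proof.
apply: (iffP forall_inP) => [cX x y xX yX | cX x xX].
  exact: (forall_inP (cX x xX)).
by apply/forall_inP => y yX; exact: cX.
Qed.

Lemma is_chain_sub X Y : X \subset Y -> is_chain Y -> is_chain X.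
Proof.
move=> /subsetP sXY /is_chainP cY; apply/is_chainP => x y xX yX.
by apply: cY; exact: sXY.
Qed.

Lemma toggle_set_chain p X : is_chain X -> is_chain (toggle_set p X).
Proof. by rewrite /toggle_set; case: ifP => [/andP[]|_] //; case: ifP => [/andP[]|]. Qed.

Lemma toggle_setK p X : is_chain X -> toggle_set p (toggle_set p X) = X.
Proof.
move=> cX; rewrite {2}/toggle_set.
have cD : is_chain (X :\ p) by apply: is_chain_sub cX; exact: subD1set.
have [pX | pX] := boolP (p \in X); rewrite /= ?cD.
  by rewrite /toggle_set !inE eqxx /= setD1K // cX.
case cU: (is_chain (p |: X)); last by rewrite /toggle_set (negPf pX) cU.
by rewrite /toggle_set !inE eqxx /= setU1K // cX.
Qed.

End ChainToggles.

Definition chains {d : Order.disp_t} (P : finPOrderType d) : Type :=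
  {X : {set P} | is_chain X}.
HB.instance Definition _ d (P : finPOrderType d) := SubFinite.on (chains P).

Section ToggleGroup.

Context {d : Order.disp_t} {P : finPOrderType d}.
Implicit Types (p : P).

Definition toggle_fun p (X : chains P) : chains P :=
  exist _ (toggle_set p (sval X)) (toggle_set_chain p (svalP X)).

Lemma toggle_funK p : involutive (toggle_fun p).
Proof. by move=> X; apply: val_inj; exact: toggle_setK (svalP X). Qed.

Definition toggle_perm p : {perm chains P} := perm (inv_inj (toggle_funK p)).

End ToggleGroup.

Definition toggle_group {d : Order.disp_t} (P : finPOrderType d)
  : {group {perm chains P}} := <<[set toggle_perm p | p : P]>>%G.

Lemma toggle_perm_in {d : Order.disp_t} {P : finPOrderType d} (p : P) :
  toggle_perm p \in toggle_group P.
Proof. by apply: mem_gen; exact: imset_f. Qed.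

(* Products in this group are left to right: s * t acts as s first, then t. *)
Definition toggle {d : Order.disp_t} {P : finPOrderType d} (p : P)
  : [subg toggle_group P] := Subg (toggle_perm_in p).

(* Main.v *)
(** Toggling [p] in a chain [X] flips the membership of [p] when [p] is
    comparable to all of [X], and does nothing otherwise. If [p] and [q] are
    comparable, toggling [q] does not affect whether [p] is comparable to all of
    [X], so the two involutions commute. If they are incomparable, the product
    squared sends the empty chain to [{p}], through [{q}], [{q}] and the empty
    chain. *)

Require Import Defs.
From mathcomp Require Import all_boot all_order all_fingroup.

Import Order.TTheory.

(** Symmetric difference with [{p}], written with xor so that two flips commute pointwise. *)
Definition flip {T : finType} (p : T) (X : {set T}) : {set T} :=
  [set x | (x == p) (+) (x \in X)].

Lemma flipC (T : finType) (p q : T) (X : {set T}) :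
  flip p (flip q X) = flip q (flip p X).
Proof. by apply/setP => x; rewrite !inE addbCA. Qed.

Section ChainToggleTheory.

Context {d : Order.disp_t} {P : finPOrderType d}.
Implicit Types (X : {set P}) (p q : P).

Definition comparable_to p X : bool := [forall x in X, (x >=< p)%O].

Lemma is_chainU1 p X : is_chain X -> is_chain (p |: X) = comparable_to p X.
Proof.
move=> /is_chainP cX; apply/is_chainP/forall_inP => [cpX x xX | cpX x y].
  by apply: cpX; rewrite !inE ?eqxx ?xX ?orbT.
rewrite !inE => /predU1P[->|xX] /predU1P[->|yX]; first exact: comparablexx.
- by rewrite comparable_sym; exact: cpX.
- exact: cpX.
- exact: cX.
Qed.

(** Removing [p] from a chain always leaves a chain, and a chain containing [p] satisfies
    [comparable_to p], so one condition governs both insertion and removal. *)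
Lemma toggle_setE p X :
  is_chain X -> toggle_set p X = if comparable_to p X then flip p X else X.
Proof.
move=> cX; rewrite /toggle_set -is_chainU1 //.
have [pX|pX] := boolP (p \in X) => /=.
  rewrite (is_chain_sub (subD1set X p) cX) (setUidPr _) ?sub1set // cX.
  by apply/setP => x; rewrite !inE; case: eqVneq => [->|]; rewrite ?pX.
case: ifP => // _; apply/setP => x.
by rewrite !inE; case: eqVneq => [->|]; rewrite ?(negPf pX).
Qed.

(** Only the membership of [q] changes, and the condition at [q] holds by hypothesis. *)
Lemma comparable_to_flip p q X :
  (p >=< q)%O -> comparable_to p (flip q X) = comparable_to p X.
Proof.
rewrite comparable_sym => qp; apply: eq_forallb => x.
by rewrite !inE; case: eqVneq => [->|]; rewrite ?qp ?implybT.
Qed.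

Lemma toggle_setC p q X : is_chain X -> (p >=< q)%O ->
  toggle_set p (toggle_set q X) = toggle_set q (toggle_set p X).
Proof.
move=> cX pq; have qp : (q >=< p)%O by rewrite comparable_sym.
rewrite (toggle_setE p) ?toggle_set_chain // (toggle_setE q (toggle_set p X))
  ?toggle_set_chain // !toggle_setE //.
(* Each condition survives the other flip, so only the case where both toggles act is left. *)
case cp: (comparable_to p X); case cq: (comparable_to q X);
  rewrite ?comparable_to_flip // ?cp ?cq //.
exact: flipC.
Qed.

Lemma toggle_perm_sqr p : (toggle_perm p * toggle_perm p = 1)%g.
Proof. by apply/permP => X; rewrite permM perm1 !permE toggle_funK. Qed.

Lemma toggle_permC p q :
  (p >=< q)%O -> commute (toggle_perm p) (toggle_perm q).
Proof.
move=> pq; apply/permP => X; rewrite !permM !permE; apply: val_inj => /=.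
by rewrite (toggle_setC p q) ?(svalP X).
Qed.

Lemma is_chain0 : is_chain (set0 : {set P}).
Proof. by apply/is_chainP => x y; rewrite inE. Qed.

Lemma is_chain1 p : is_chain [set p].
Proof. by apply/is_chainP => x y /set1P-> /set1P->; exact: comparablexx. Qed.

Lemma toggle_set0 p : toggle_set p set0 = [set p].
Proof. by rewrite /toggle_set inE setU0 is_chain1. Qed.

Lemma toggle_set1_incomparable p q :
  ~~ (p >=< q)%O -> toggle_set p [set q] = [set q].
Proof.
move=> npq; rewrite toggle_setE ?is_chain1 //; case: ifP => // /forall_inP.
by move=> /(_ q (set11 q)); rewrite comparable_sym (negPf npq).
Qed.

Lemma toggle_set1 p : toggle_set p [set p] = set0.
Proof. by rewrite -[in LHS]toggle_set0 toggle_setK ?is_chain0. Qed.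

End ChainToggleTheory.

(** The factor [toggle q] stands on the left because it acts first, as in the composition $t_p
    t_q$. *)
Theorem lemma3p6 (d : Order.disp_t) (P : finPOrderType d) (p q : P) :
  ((toggle q * toggle p) ^+ 2 = 1)%g <-> (p >=< q)%O.
Proof.
split=> [/(congr1 sgval) /= E | pq]; last first.
  apply: val_inj => /=.
  (* Swapping the middle factors turns [q p q p] into [q q p p]. *)
  rewrite mulgA -(mulgA (toggle_perm q)) (toggle_permC p q pq).
  by rewrite mulgA toggle_perm_sqr mul1g toggle_perm_sqr.
apply: contraT => npq.
have /(congr1 sval) := congr1
  (fun s : {perm chains P} => s (exist (fun X => is_chain X) set0 is_chain0)) E.
rewrite !permM perm1 !permE /= toggle_set0 toggle_set1_incomparable //.
by rewrite toggle_set1 toggle_set0 => /setP/(_ p); rewrite !inE eqxx.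
Qed.
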